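(* Let $X$ be a mixed-stable sequence with respect to a full BST $T$, and assume $X$ is a whole multiple of its atomic sequence. Then $$\mathrm{cost}(GF,X,T)<\tfrac52\cdot\mathrm{cost}(OPT,X,T).$$ If $X$ is strongly-stable, then $\mathrm{cost}(GF,X,T)<2\cdot\mathrm{cost}(OPT,X,T)$.
   Context: Binary search tree model. Keys are $\{1,\dots,n\}$. A query sequence is $X=[x_1,\dots,x_m]$, and $T_0$ is an initial BST. An algorithm $A$ serves $x_1,\dots,x_m$ in order. Before serving $x_t$ it holds a BST $T_{t-1}$; it searches $x_t$ from the root and may then restructure the tree by rotations into $T_t$. Let $P_t$ be the set of nodes on the root-to-$x_t$ path of $T_{t-1}$, and let $U_t$ be the node set of the minimal subtree containing all edges rotated in transforming $T_{t-1}$ into $T_t$. The cost at time $t$ is $|P_t\cup U_t|$, and $\mathrm{cost}(A,X,T_0)$ is the sum of these costs. $OPT$ denotes an algorithm of minimum cost on $(X,T_0)$ that knows all of $X$ in advance. Greedy Future ($GF$). After finding $x_t$ in $T_{t-1}$, let $v_1<\dots<v_k$ be the keys on the root-to-$x_t$ path, set $v_0=-\infty$ and $v_{k+1}=+\infty$, and let $R_0,\dots,R_k$ be the subtrees hanging off this path. For each $i$, $\tau(v_i)$ is the smallest $s>t$ with $x_s\in(v_{i-1},v_{i+1})$, or $+\infty$ if there is none. $GF$ rearranges $v_1,\dots,v_k$ as a treap: a BST in key order and a heap in $\tau$, with the smallest $\tau$ at the top. Ties in $\tau$ are broken in favor of the node of smaller depth in $T_{t-1}$. It then reattaches $R_0,\dots,R_k$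 unchanged at their unique positions, giving $T_t$. Stable sequences. Let $T$ be a full binary search tree (every inner node has exactly two children), and let $X$ be a query sequence consisting only of keys stored at leaves of $T$. For an inner node $v$, let $X_v$ be the subsequence of $X$ consisting of the queries to keys in the subtree of $v$. - The node $v$ is strongly-stable if consecutive queries of $X_v$ alternate between the left and right subtrees of $v$. - The node $v$ is weakly-stable with a left bias if its left child $u$ is an inner node and $X_v$ repeats cyclically (from some starting phase) the pattern: a query in the left subtree of $u$, then one in the right subtree of $u$, then one in the right subtree of $v$. - Weakly-stable with a right bias is the mirror image: $u$ is the right child of $v$, and the pattern is right subtree of $u$, left subtree of $u$, left subtree of $v$. In both weakly-stable cases $u$ is called the favored child of $v$. $X$ (and $T$) is mixed-stable if every inner node of $T$ is strongly-stable or weakly-stable, and strongly-stable if every inner node is strongly-stable. The atomic sequence is the shortest such stable sequence all of whose repetitions are again such stable sequences. $X$ is a whole multiple of it if it is a concatenation of copies of it. *)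

(* Defs.v *)
From mathcomp Require Import all_boot.

Set Implicit Arguments.
Unset Strict Implicit.
Unset Printing Implicit Defensive.

(* Binary search trees over nat keys.  [Leaf] is the empty tree; a     *)
(* node with two [Leaf] children is a *leaf node* of the BST.          *)
Inductive tree := Leaf | Node of tree & nat & tree.

Fixpoint keys (t : tree) : seq nat :=
  if t is Node l k r then keys l ++ k :: keys r else [::].

Definition bst_on (n : nat) (t : tree) : Prop := keys t = iota 1 n.

Fixpoint leaf_keys (t : tree) : seq nat :=
  match t with
  | Leaf => [::]
  | Node Leaf k Leaf => [:: k]
  | Node l _ r => leaf_keys l ++ leaf_keys r
  end.

Fixpoint full (t : tree) : bool :=
  match t with
  | Leaf => true
  | Node Leaf _ Leaf => true
  | Node (Node _ _ _ as l) _ (Node _ _ _ as r) => full l && full r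
  | _ => false
  end.

Definition is_node (t : tree) : bool := if t is Node _ _ _ then true else false.

Definition is_inner (t : tree) : bool :=
  if t is Node l _ r then is_node l || is_node r else false.

Fixpoint spath (q : nat) (t : tree) : seq nat :=
  match t with
  | Leaf => [::]
  | Node l k r =>
      k :: (if q < k then spath q l else if k < q then spath q r else [::])
  end.

Fixpoint rotup (x : nat) (t : tree) : option (tree * nat) :=
  match t with
  | Leaf => None
  | Node l k r =>
      if x < k then
        match l with
        | Node a y b =>
            if y == x then Some (Node a y (Node b k r), k)
            else if rotup x l is Some (l', p) then Some (Node l' k r, p) else None
        | Leaf => None
        end
      else if k < x then
        match r with
        | Node a y b =>
            if y == x then Some (Node (Node l k a) y b, k)
            else if rotup x r is Some (r', p) then Some (Node l k r', p) else None
        | Leaf => None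
        end
      else None
  end.

Fixpoint rots (xs : seq nat) (t : tree) : option (tree * seq nat) :=
  match xs with
  | [::] => Some (t, [::])
  | x :: xs' =>
      match rotup x t with
      | Some (t1, p) =>
          match rots xs' t1 with
          | Some (t2, E) => Some (t2, x :: p :: E)
          | None => None
          end
      | None => None
      end
  end.

(* node set of the minimal (connected) subtree of t containing all keys
   of E: v is an ancestor-or-self of some key of E, and lies below every
   common ancestor of all keys of E.  Empty when E is empty. *)
Definition steiner (t : tree) (E : seq nat) : seq nat :=
  [seq v <- keys t |
     has (fun e => v \in spath e t) E &&
     all (fun w => all (fun e => w \in spath e t) E ==> (w \in spath v t))
         (keys t)].

Fixpoint exec (t : tree) (qs : seq nat) (R : seq (seq nat))
  : option (nat * seq tree) :=
  match qs, R with
  | [::], [::] => Some (0, [::])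
  | q :: qs', xs :: R' =>
      match rots xs t with
      | Some (t', E) =>
          match exec t' qs' R' with
          | Some (c, Ts) =>
              Some (size (undup (spath q t ++ steiner t E)) + c, t' :: Ts)
          | None => None
          end
      | None => None
      end
  | _, _ => None
  end.

Definition OPT_cost (T0 : tree) (X : seq nat) (c : nat) : Prop :=
  (exists R Ts, exec T0 X R = Some (c, Ts)) /\
  (forall R c' Ts, exec T0 X R = Some (c', Ts) -> c <= c').

Fixpoint hang (q : nat) (t : tree) : seq tree :=
  match t with
  | Leaf => [:: Leaf]
  | Node l k r =>
      if q < k then rcons (hang q l) r
      else if k < q then l :: hang q r
      else [:: l; r]
  end.

Definition in_open (lo hi : option nat) (x : nat) : bool :=
  (if lo is Some a then a < x else true) && (if hi is Some b then x < b else true).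

(* tau: smallest s > t (1-indexed) with x_s in (lo, hi); if there is
   none we return size X + 1, which plays the role of +infinity (it is
   larger than every real index and equal for all "infinite" nodes). *)
Definition tau (X : seq nat) (t : nat) (lo hi : option nat) : nat :=
  t.+1 + find (in_open lo hi) (drop t X).

Definition ltlex (p q : nat * nat) : bool :=
  (p.1 < q.1) || ((p.1 == q.1) && (p.2 < q.2)).

Fixpoint amin (ps : seq (nat * nat)) : nat :=
  match ps with
  | [::] => 0
  | p :: ps' =>
      if ps' is [::] then 0
      else let j := amin ps' in if ltlex (nth p ps' j) p then j.+1 else 0
  end.

(* treap on the sorted keys vs (with priorities), hanging subtrees Rs
   (size Rs = size vs + 1) reattached at their positions *)
Fixpoint build (fuel : nat) (vs : seq (nat * (nat * nat))) (Rs : seq tree)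
  : tree :=
  match fuel with
  | 0 => head Leaf Rs
  | f.+1 =>
      if vs is [::] then head Leaf Rs
      else
        let j := amin (map snd vs) in
        Node (build f (take j vs) (take j.+1 Rs))
             (nth 0 (map fst vs) j)
             (build f (drop j.+1 vs) (drop j.+1 Rs))
  end.

Definition gf_step (X : seq nat) (t : nat) (T : tree) : tree :=
  let q := nth 0 X t.-1 in
  let P := spath q T in
  let vs := sort leq P in
  let k := size vs in
  let pr i :=
    let v := nth 0 vs i in
    let lo := if i == 0 then None else Some (nth 0 vs i.-1) in
    let hi := if i.+1 < k then Some (nth 0 vs i.+1) else None in
    (v, (tau X t lo hi, index v P)) in
  build k (map pr (iota 0 k)) (hang q T).

Fixpoint gf_run (T0 : tree) (X : seq nat) (t : nat) : tree :=
  if t is t'.+1 then gf_step X t (gf_run T0 X t') else T0.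

Definition GF_exec (T0 : tree) (X : seq nat) (R : seq (seq nat)) : Prop :=
  exists c, exec T0 X R = Some (c, [seq gf_run T0 X t | t <- iota 1 (size X)]).

Definition GF_cost (T0 : tree) (X : seq nat) (c : nat) : Prop :=
  (exists R Ts, GF_exec T0 X R /\ exec T0 X R = Some (c, Ts)) /\
  (forall R c' Ts, GF_exec T0 X R -> exec T0 X R = Some (c', Ts) -> c <= c').

Definition sub_seq (t : tree) (X : seq nat) : seq nat :=
  [seq x <- X | x \in keys t].

Definition strong_node (t : tree) (X : seq nat) : bool :=
  if t is Node l _ _ then
    sorted (fun a b => (a \in keys l) != (b \in keys l)) (sub_seq t X)
  else false.

Definition cyclic3 (cls : nat -> nat) (Xv : seq nat) : bool :=
  has (fun p => all (fun i => cls (nth 0 Xv i) == (i + p) %% 3)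
                    (iota 0 (size Xv)))
      (iota 0 3).

Definition weakL_node (t : tree) (X : seq nat) : bool :=
  match t with
  | Node (Node ll _ lr as u) _ r =>
      is_inner u &&
      cyclic3 (fun x => if x \in keys ll then 0 else if x \in keys lr then 1 else 2)
              (sub_seq t X)
  | _ => false
  end.

Definition weakR_node (t : tree) (X : seq nat) : bool :=
  match t with
  | Node l _ (Node ul _ ur as u) =>
      is_inner u &&
      cyclic3 (fun x => if x \in keys ur then 0 else if x \in keys ul then 1 else 2)
              (sub_seq t X)
  | _ => false
  end.

Fixpoint all_inner (P : tree -> bool) (t : tree) : bool :=
  if t is Node l _ r then
    (is_inner t ==> P t) && all_inner P l && all_inner P r
  else true.

Definition mixed_stable (T : tree) (X : seq nat) : bool :=
  full T && all (fun x => x \in leaf_keys T) X &&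
  all_inner (fun t => [|| strong_node t X, weakL_node t X | weakR_node t X]) T.

Definition strongly_stable (T : tree) (X : seq nat) : bool :=
  full T && all (fun x => x \in leaf_keys T) X &&
  all_inner (fun t => strong_node t X) T.

Definition repeat_seq (A : seq nat) (j : nat) : seq nat := flatten (nseq j A).

Definition atomic_cand (st : tree -> seq nat -> bool) (T : tree)
  (X A : seq nat) : Prop :=
  0 < size A /\
  (forall j, 0 < j -> st T (repeat_seq A j)) /\
  (forall i, i < size X -> nth 0 X i = nth 0 A (i %% size A)).

Definition atomic (st : tree -> seq nat -> bool) (T : tree) (X A : seq nat)
  : Prop :=
  atomic_cand st T X A /\
  (forall B, atomic_cand st T X B -> size A <= size B).

Definition whole_multiple (st : tree -> seq nat -> bool) (T : tree)
  (X : seq nat) : Prop :=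
  exists A k, atomic st T X A /\ X = repeat_seq A k.

(* Main.v *)
(* Greedy Future never restructures the tree: just after a query below an inner
   node v, the next query below v falls in a gap of the search path adjacent to
   v, so tau is nondecreasing along the path and the depth tie-break rebuilds
   the same treap. Its cost is therefore at most m + sum_v n_v, where m is the
   length of X and n_v the number of queries below the inner node v.

   For OPT, fix the tree T as reference. In any search tree on the same keys the
   two sides of an inner node v have a transition point: the topmost key of one
   side, provided it is not above the whole of v. It is never the root, distinct
   nodes have distinct transition points, and it stays one until it is touched;
   two consecutive queries on different sides of v touch it. So OPT costs at
   least m plus the number of disjoint alternating pairs of queries over all v.

   Periodicity makes a strong node contribute n_v / 2 pairs; a weak node with n_v
   = 3c and its favored child with 2c queries contribute c pairs each, which
   gives the ratios 2 and 5/2, made strict by the term m. *)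
From HB Require Import structures.
Require Import Defs.
From mathcomp Require Import all_boot zify.

Set Implicit Arguments.
Unset Strict Implicit.
Unset Printing Implicit Defensive.

(** * Search trees and their inner nodes *)

Lemma tree_comparable : comparable tree.
Proof. by rewrite /comparable /decidable; decide equality; case: (eqVneq n n0) => [->|/eqP]; [left|right]. Qed.

HB.instance Definition _ := hasDecEq.Build tree (compareP tree_comparable).

(** The search-tree order and convexity in one condition. Unlike [bst_on] it leaves the first key
    free, so it passes to subtrees. *)
Definition interval_tree (t : tree) : Prop :=
  exists a, keys t = iota a (size (keys t)).

Lemma interval_node l k r : interval_tree (Node l k r) ->
  [/\ interval_tree l, interval_tree r,
      forall x, x \in keys l -> x < k & forall x, x \in keys r -> k < x].
Proof.
case=> a /=; rewrite size_cat /= iotaD => /eqP.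
rewrite eqseq_cat ?size_iota //= => /andP[/eqP kl /eqP[-> kr]].
split; [by exists a | by exists (a + size (keys l)).+1 | |] => x.
  by rewrite {1}kl mem_iota => /andP[].
by rewrite {1}kr mem_iota => /andP[].
Qed.

Lemma interval_convex t x y z : interval_tree t ->
  x \in keys t -> z \in keys t -> x <= y <= z -> y \in keys t.
Proof. by case=> a ->; rewrite !mem_iota; lia. Qed.

Lemma mem_keys l k r x :
  (x \in keys (Node l k r)) = [|| x \in keys l, x == k | x \in keys r].
Proof. by rewrite mem_cat inE. Qed.

Lemma spath_sub q t : {subset spath q t <= keys t}.
Proof.
elim: t => //= l IHl k r IHr x; rewrite inE mem_cat inE.
case: (x == k) => //=; first by rewrite orbT.
by case: ifP => _ => [/IHl ->|] //; case: ifP => _ => [/IHr ->|] //; rewrite orbT.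
Qed.

Lemma spath_self t x : interval_tree t -> x \in keys t -> x \in spath x t.
Proof.
elim: t => //= l IHl k r IHr /interval_node[il ir lk rk].
rewrite mem_cat !inE.
case: ltngtP => //= xk; rewrite ?orbT //.
  by case/orP => [/IHl->//|/rk]; lia.
by case/orP => [/lk|/IHr->//]; lia.
Qed.

Lemma spath_anti t x y : interval_tree t ->
  x \in spath y t -> y \in spath x t -> x = y.
Proof.
elim: t => //= l IHl k r IHr /interval_node[il ir lk rk].
rewrite !inE.
case: (ltngtP y k) => yk /=; case: (ltngtP x k) => xk //=; try by lia.
- exact: IHl.
- by move=> /spath_sub /lk; lia.
- by move=> /spath_sub /rk; lia.
- exact: IHr.
Qed.

(** A node is represented by the subtree rooted at it, so sums over [inner t] run over the inner
    nodes. *)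
Fixpoint inner (t : tree) : seq tree :=
  if t is Node l _ r then
    (if is_inner t then [:: t] else [::]) ++ inner l ++ inner r
  else [::].

Lemma inner_node l k r : is_inner (Node l k r) ->
  inner (Node l k r) = Node l k r :: inner l ++ inner r.
Proof. by move=> /= ->. Qed.

Lemma all_innerE P t : all_inner P t = all P (inner t).
Proof.
elim: t => //= l -> k r ->; rewrite !all_cat -andbA.
by case: (_ || _) => //=; rewrite andbT.
Qed.

Lemma inner_is_inner t v : v \in inner t -> is_inner v.
Proof.
elim: t => //= l IHl k r IHr; rewrite !mem_cat => /or3P[|/IHl//|/IHr//].
by case: ifP => // h; rewrite inE => /eqP->.
Qed.

Lemma inner_keys t v : v \in inner t -> {subset keys v <= keys t}.
Proof.
elim: t => // l IHl k r IHr /=; rewrite !mem_cat => /or3P[|/IHl s|/IHr s].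
- by case: ifP => // h; rewrite inE => /eqP->.
- by move=> x /s; rewrite mem_cat => ->.
- by move=> x /s; rewrite mem_cat inE => ->; rewrite !orbT.
Qed.

Lemma inner_interval t v : interval_tree t -> v \in inner t -> interval_tree v.
Proof.
elim: t => // l IHl k r IHr it /=; have [il ir _ _] := interval_node it.
rewrite !mem_cat => /or3P[|/(IHl il)//|/(IHr ir)//].
by case: ifP => // h; rewrite inE => /eqP->.
Qed.

Lemma full_node l k r : full (Node l k r) ->
  (l = Leaf /\ r = Leaf) \/ [/\ is_node l, is_node r, full l & full r].
Proof.
by case: l r => [|a x b] [|c y d] //; [left | case/andP; right].
Qed.

Lemma inner_full t v : full t -> v \in inner t -> full v.
Proof.
elim: t => // l IHl k r IHr ft; case: (full_node ft) => [[-> ->]//|[_ _ fl fr]] /=.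
rewrite !mem_cat => /or3P[|/(IHl fl)//|/(IHr fr)//].
by case: ifP => // h; rewrite inE => /eqP->.
Qed.

Lemma full_inner_node l k r : full (Node l k r) -> is_inner (Node l k r) ->
  [/\ is_node l, is_node r, full l & full r].
Proof. by move=> /full_node[[-> ->]|]. Qed.

Lemma leaf_keys_sub t : {subset leaf_keys t <= keys t}.
Proof.
elim: t => //= l IHl k r IHr x.
have : x \in leaf_keys l ++ leaf_keys r -> x \in keys l ++ k :: keys r.
  by rewrite !mem_cat inE => /orP[/IHl->//|/IHr->]; rewrite !orbT.
by case: l r {IHl IHr} => [|a y b] [|c z d].
Qed.

Lemma leaf_keys_node l k r : is_inner (Node l k r) ->
  leaf_keys (Node l k r) = leaf_keys l ++ leaf_keys r.
Proof. by case: l r => [|a y b] [|c z d]. Qed.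

Lemma leaf_keys_neq t l k r : interval_tree t -> Node l k r \in inner t ->
  k \notin leaf_keys t.
Proof.
elim: t => // l1 IHl k1 r1 IHr it vt.
have [il ir lk rk] := interval_node it.
case h: (is_inner (Node l1 k1 r1)); last first.
  by move: h vt => /=; case: l1 r1 {IHl IHr it il ir lk rk} => [|? ? ?] [|? ? ?].
rewrite leaf_keys_node // mem_cat negb_or.
move: vt; rewrite inner_node // inE mem_cat => /or3P[|vl|vr].
- move=> /eqP[_ -> _].
  by apply/andP; split; apply/negP => /leaf_keys_sub; [move/lk|move/rk]; rewrite ltnn.
- rewrite (IHl il vl) /=; apply/negP => /leaf_keys_sub /rk.
  have /lk : k \in keys l1 by apply: (inner_keys vl); rewrite mem_keys eqxx orbT.
  lia.
- rewrite (IHr ir vr) andbT; apply/negP => /leaf_keys_sub /lk.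
  have /rk : k \in keys r1 by apply: (inner_keys vr); rewrite mem_keys eqxx orbT.
  lia.
Qed.

(** The path to a leaf consists of the inner nodes above it and the leaf itself, which accounts for
    the successor. *)
Lemma size_spath t (x : nat) : interval_tree t -> full t -> x \in leaf_keys t ->
  size (spath x t) <= (\sum_(v <- inner t) (x \in keys v)).+1.
Proof.
elim: t => // l IHl k r IHr it ft.
have [il ir lk rk] := interval_node it.
have [[-> ->] /=|[nl nr fl fr]] := full_node ft; first by rewrite big_nil inE => /eqP->; rewrite ltnn.
have h : is_inner (Node l k r) by rewrite /= nl.
move=> xt; have xk := leaf_keys_sub xt.
move: xt; rewrite leaf_keys_node // inner_node // big_cons xk big_cat /= mem_cat.
case/orP => xl; have := leaf_keys_sub xl; [move/lk => ltk|move/rk => ltk].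
  by rewrite ltk /= ltnS; apply: leq_trans (IHl il fl xl) _; rewrite add1n ltnS leq_addr.
rewrite ltk [x < k]ltnNge (ltnW ltk) /= ltnS.
by apply: leq_trans (IHr ir fr xl) _; rewrite add1n ltnS leq_addl.
Qed.

(** * Alternating pairs in words *)

(* Greedy number of disjoint pairs of unequal letters; o is the pending first
   letter of the current pair. *)
Fixpoint alt_pairs (o : option bool) (s : seq bool) : nat :=
  if s is b :: s' then
    if o is Some c then
      if b == c then alt_pairs o s' else (alt_pairs None s').+1
    else alt_pairs (Some b) s'
  else 0.

(** A pending letter can only bring pairs forward, and it belongs to a single pair. *)
Lemma alt_pairs_mono o s :
  alt_pairs None s <= alt_pairs o s <= (alt_pairs None s).+1.
Proof.
elim: s o => [|b s IH] [c|] //=; last by rewrite leqnn leqnSn.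
case: eqP => [->|_]; first by rewrite leqnn leqnSn.
by have := IH (Some b); lia.
Qed.

Lemma alt_pairs_negb o s :
  alt_pairs (omap negb o) (map negb s) = alt_pairs o s.
Proof.
elim: s o => [|b s IH] [c|] //=; last exact: IH (Some b).
have <- : (b == c) = (~~ b == ~~ c) by case: b c => [] [].
by rewrite (IH (Some c)) (IH None).
Qed.

Definition alternating : seq bool -> bool := sorted (fun a b => a != b).

Lemma alternating_pairs s : alternating s -> size s <= (alt_pairs None s).*2.+1.
Proof.
have [n le] := ubnP (size s); elim: n s le => // n IH [|a [|b s]] //= le.
move=> /andP[ab ps]; rewrite eq_sym (negbTE ab).
have := IH s (ltac:(lia)); rewrite /alternating.
by have /path_sorted -> := ps => /(_ isT); lia.
Qed.

(* That is, s alternates when read as a cyclic word. *)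
Lemma alternating_cyclic_even s :
  alternating (rcons s (head true s)) -> ~~ odd (size s).
Proof.
case: s => // a s /=.
suff H b : path (fun x y => x != y) b (rcons s a) -> odd (size s) = (a == b).
  by move/H; rewrite eqxx /= => ->.
elim: s b => [|c s IH] b /=; first by rewrite andbT eq_sym => /negbTE.
by case/andP=> bc /IH ->; case: a b c bc {IH} => [] [] [].
Qed.

(** * Words of period three *)

(** The queries at a weak node, from phase [p]: 0 and 1 are the outer and inner subtree of the
    favored child, 2 is the other child. *)
Definition cyc3 (p n : nat) : seq nat := [seq (i + p) %% 3 | i <- iota 0 n].

Lemma size_cyc3 p n : size (cyc3 p n) = n.
Proof. by rewrite size_map size_iota. Qed.

Lemma cyc3_add3 p n :
  cyc3 p n.+3 = [:: p %% 3; p.+1 %% 3; p.+2 %% 3] ++ cyc3 p n.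
Proof.
rewrite /cyc3 /= !add0n !add1n !add2n; do 3!congr (_ :: _).
rewrite -[3]/(3 + 0) iotaDl -map_comp; apply: eq_map => i /=.
by rewrite -addnA modnDl.
Qed.

Lemma mod3_cases p : let m := p %% 3 in let m1 := p.+1 %% 3 in let m2 := p.+2 %% 3 in
  [\/ [/\ m = 0, m1 = 1 & m2 = 2], [/\ m = 1, m1 = 2 & m2 = 0]
    | [/\ m = 2, m1 = 0 & m2 = 1]].
Proof.
move=> m m1 m2; have : m < 3 by rewrite ltn_mod.
have -> : m1 = (m + 1) %% 3 by rewrite modnDml addn1.
have -> : m2 = (m + 2) %% 3 by rewrite modnDml addn2.
by case: m => [|[|[|]]] // _; [apply: Or31|apply: Or32|apply: Or33].
Qed.

(** In each phase a block of three letters completes one pair, and a letter left pending does not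
    reduce later pairs. *)
Lemma cyc3_pairs p c :
  c <= alt_pairs None [seq x != 2 | x <- cyc3 p (c * 3)].
Proof.
elim: c => // c IH; rewrite mulSn cyc3_add3 map_cat.
set s := map _ (cyc3 _ _) in IH *.
by case: (mod3_cases p) => -[/= -> -> ->] /=; have := alt_pairs_mono (Some true) s;
  have := alt_pairs_mono (Some false) s; lia.
Qed.

(** Deleting the letter 2 leaves one 0 and one 1 in each block, which form a pair. *)
Lemma cyc3_favored p c :
  let s := [seq x == 0 | x <- cyc3 p (c * 3) & x != 2] in
  size s = c.*2 /\ c <= alt_pairs None s.
Proof.
elim: c => // c [IH1 IH2]; rewrite mulSn cyc3_add3 filter_cat map_cat.
set s := map _ _ in IH1 IH2 *.
by case: (mod3_cases p) => -[/= -> -> ->] /=; rewrite IH1; lia.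
Qed.

(** Among four consecutive letters some 0 is followed by a 1, and both lie on the same side. *)
Lemma cyc3_alternating p n :
  alternating [seq x != 2 | x <- cyc3 p n] -> n <= 3.
Proof.
case: n => [|[|[|[|n]]]] //; rewrite cyc3_add3 /cyc3 /= add0n.
by case: (mod3_cases p) => -[/= -> -> ->].
Qed.

(** Compare the letter at position [n] with the letter at position 0. *)
Lemma cyc3_periodic p a n : a > 0 ->
  cyc3 p (n + a) = cyc3 p n ++ cyc3 p a -> 3 %| n.
Proof.
move=> a0; rewrite /cyc3 iotaD map_cat => /eqP; rewrite eqseq_cat // eqxx /=.
case: a a0 => // a _ /= /andP[]; rewrite !add0n => /eqP h _.
by have := modn_small (isT : 0 < 3); lia.
Qed.

(** * Transition points and the lower bound for OPT *)

Definition root_key (t : tree) : nat := if t is Node _ k _ then k else 0.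

Definition sides (v : tree) (X : seq nat) : seq bool :=
  [seq x <= root_key v | x <- sub_seq v X].

(** A transition point as in Wilber's interleave bound: [t] is the current tree, [v] a subtree of
    the reference tree. The root key of [v] is counted on the left, so the two sides partition the
    keys of [v]. *)
Definition transition (t v : tree) (z : nat) : bool :=
  [&& z \in keys v,
      all (fun x => ((x <= root_key v) == (z <= root_key v)) ==> (z \in spath x t))
        (keys v)
    & ~~ all (fun x => z \in spath x t) (keys v)].

(** Descend from the root: while the current key is outside [S], convexity puts all of [S] on one
    side of it. *)
Lemma common_ancestor (t : tree) (S : pred nat) a : interval_tree t ->
  S a -> (forall x, S x -> x \in keys t) ->
  (forall x y z, S x -> S z -> x <= y <= z -> S y) ->
  exists2 z, S z & forall x, S x -> z \in spath x t.
Proof.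
move=> + Sa; elim: t => [_ /(_ a Sa)//|l IHl k r IHr it sub conv].
have [il ir lk rk] := interval_node it.
have [Sk|nSk] := boolP (S k); first by exists k => // x _ /=; rewrite inE eqxx.
have sep x y : S x -> S y -> (x < k) = (y < k).
  move=> Sx Sy; case: (ltngtP x k) => xk; case: (ltngtP y k) => yk //.
  - by rewrite (conv x k y) // (ltnW xk) (ltnW yk) in nSk.
  - by rewrite -yk Sy in nSk.
  - by rewrite (conv y k x) // (ltnW xk) (ltnW yk) in nSk.
  - by rewrite -xk Sx in nSk.
have neq x : S x -> x != k by apply: contraTneq => ->.
have [ak|ka] := boolP (a < k).
  have lt x : S x -> x < k by move/(sep x a)/(_ Sa) => ->.
  have [|z Sz az] := IHl il _ conv.
    move=> x Sx; have := sub x Sx; rewrite mem_keys (negbTE (neq x Sx)) /=.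
    by case/orP => // /rk; have := lt x Sx; lia.
  by exists z => // x Sx /=; rewrite (lt x Sx) inE az ?orbT.
have lt x : S x -> k < x.
  by move=> Sx; have := neq x Sx; have := sep x a Sx Sa; rewrite (negbTE ka); lia.
have [|z Sz az] := IHr ir _ conv.
  move=> x Sx; have := sub x Sx; rewrite mem_keys (negbTE (neq x Sx)) /=.
  by case/orP => // /lk; have := lt x Sx; lia.
exists z => // x Sx /=; have := lt x Sx; rewrite inE; case: ltngtP => // _ _.
by rewrite az ?orbT.
Qed.

(** The topmost key [w] of [v] lies on one side; the topmost key [z] of the other side is not above
    [w], by antisymmetry of the ancestor relation. *)
Lemma transition_exists t l k r : interval_tree t -> interval_tree (Node l k r) ->
  {subset keys (Node l k r) <= keys t} -> is_node r ->
  exists z, transition t (Node l k r) z.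
Proof.
set v := Node l k r => it iv sub nr.
have kv : k \in keys v by rewrite mem_keys eqxx orbT.
have [k' k'v kk'] : exists2 k', k' \in keys v & k < k'.
  case: r @v nr iv {sub kv} => // rl c rr v _ iv; have [_ _ _ h] := interval_node iv.
  by exists c; [|apply: h]; rewrite !mem_keys eqxx !orbT.
have [|x y z|w wv wa] := @common_ancestor t (mem (keys v)) k it kv.
- exact: sub.
- by move=> xv zv; apply: (interval_convex iv xv zv).
(* [S] is the side without [w]; it contains [k] if it is the left side and [k'] if it is the right
   one. *)
pose S := [pred x | (x \in keys v) && ((x <= k) != (w <= k))].
have [a Sa] : exists a, S a.
  by case: (leqP w k) => wk; [exists k'|exists k]; rewrite /= ?kv ?k'v ?leqnn /=; lia.
have [x /andP[/sub]//|x y z|z /andP[zv zw] za] := common_ancestor it Sa.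
  move=> /= /andP[xv xw] /andP[zv zw] xyz; rewrite (interval_convex iv xv zv xyz) /=.
  by lia.
exists z; apply/and3P; split=> //=.
  apply/allP => x xv; apply/implyP => /eqP xz; apply: za.
  by rewrite /= xv /= xz.
apply/allPn; exists w => //; apply/negP => zpw.
by have := spath_anti it zpw (wa z zv); move=> h; rewrite h eqxx in zw.
Qed.

(** All of [v] lies on one side of the root. A shared [z] would be on that side too, hence above the
    whole of [v], which the last clause of [transition] forbids. *)
Lemma transition_disjoint t l k r v z : interval_tree (Node l k r) ->
  v \in inner l ++ inner r -> transition t (Node l k r) z -> ~~ transition t v z.
Proof.
move=> it vlr /and3P[zT /allP az _]; apply/negP => /and3P[zv _ /allPn[x xv]] /negP; apply.
have [_ _ lk rk] := interval_node it.
move: vlr; rewrite mem_cat => /orP[] vi; have vs := inner_keys vi.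
  apply: (implyP (az x _)); first by rewrite mem_keys vs.
  by have /lk := vs _ zv; have /lk := vs _ xv; rewrite /=; lia.
apply: (implyP (az x _)); first by rewrite mem_keys vs ?orbT.
by have /rk := vs _ zv; have /rk := vs _ xv; rewrite /=; lia.
Qed.

(** Choose one touched transition point per node. Choices from the two children differ because their
    key sets are disjoint, and the choice at the root differs from both by [transition_disjoint]. *)
Lemma transitions_touched T t (U : seq nat) : interval_tree T ->
  exists zs : seq nat,
    [/\ uniq zs, size zs = \sum_(v <- inner T) has (transition t v) U
      & forall z, z \in zs -> z \in U /\ exists2 v, v \in inner T & transition t v z].
Proof.
elim: T => [_|l IHl k r IHr it]; first by exists [::]; rewrite /= big_nil.
have [il ir lk rk] := interval_node it.
have [zl [ul sl ml]] := IHl il; have [zr [ur sr mr]] := IHr ir.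
have ulr : uniq (zl ++ zr).
  rewrite cat_uniq ul ur andbT /=; apply/hasPn => z /mr[_ [v vr /and3P[zv _ _]]].
  apply/negP => /ml[_ [w wl /and3P[zw _ _]]].
  by have /lk := inner_keys wl zw; have /rk := inner_keys vr zv; lia.
have mlr z : z \in zl ++ zr ->
    z \in U /\ exists2 v, v \in inner l ++ inner r & transition t v z.
  rewrite mem_cat => /orP[/ml|/mr] [zU [v vi tv]]; split=> //; exists v => //;
  by rewrite mem_cat vi ?orbT.
case h: (is_inner (Node l k r)); last first.
  exists (zl ++ zr); split=> //.
    by rewrite size_cat sl sr /=; rewrite /= in h; rewrite h /= big_cat.
  by move=> z /mlr[zU [v vi tv]]; split=> //; exists v => //=; rewrite mem_cat vi orbT.
rewrite inner_node // big_cons big_cat /= -sl -sr -size_cat.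
have [/hasP[z zU tz]|_] := boolP (has _ U).
  exists (z :: zl ++ zr); split=> //=.
    rewrite ulr andbT; apply/negP => /mlr[_ [v vi tv]].
    by have := transition_disjoint it vi tz; rewrite tv.
  move=> y; rewrite inE => /orP[/eqP->|/mlr[yU [v vi tv]]]; split=> //.
    by exists (Node l k r) => //; rewrite inE eqxx.
  by exists v => //; rewrite inE vi orbT.
exists (zl ++ zr); split=> // z /mlr[zU [v vi tv]]; split=> //.
by exists v => //; rewrite inE vi orbT.
Qed.

(** The root of the current tree is above every key, so it is no transition point and adds one to
    the count. *)
Lemma touched_count T t U l k r : interval_tree T -> t = Node l k r -> k \in U ->
  (\sum_(v <- inner T) has (transition t v) U).+1 <= size (undup U).
Proof.
move=> iT et kU; have [zs [uz sz mz]] := transitions_touched t U iT.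
rewrite -sz -[_.+1]/(size (k :: zs)); apply: uniq_leq_size => /= [|z].
  rewrite uz andbT; apply/negP => /mz[_ [v _ /and3P[_ _ /allPn[x _]]]].
  by rewrite et /= inE eqxx.
by rewrite inE mem_undup => /orP[/eqP->|/mz[]].
Qed.

(** * Rotations and the ancestor relation *)

(** A rotation changes the descendants of only the two ends of the rotated edge. *)
Lemma rotupP x t t' p : rotup x t = Some (t', p) ->
  [/\ keys t' = keys t, x \in keys t, p \in keys t &
      forall z y, z != x -> z != p -> (z \in spath y t') = (z \in spath y t)].
Proof.
elim: t t' p => // l IHl k r IHr t' p; rewrite [rotup _ _]/=.
case: ltngtP => // xk.
  case: l IHl => // a y b IHl; case: eqP => [eyx [<- <-]|_].
    rewrite eyx; split=> /=; rewrite -?catA ?mem_cat /= ?inE ?eqxx ?orbT // => z w zx zk.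
    case: (ltngtP w k) => wk; case: (ltngtP w x) => wx; rewrite /= ?wk ?wx ?inE ?(negbTE zx) ?(negbTE zk) //; try lia.
  case E: rotup => [[l' p']|] // [<- <-]; have [ek mx mp sp] := IHl _ _ E.
  split=> [|||z w zx zp]; rewrite ?(mem_keys (Node a y b)) ?mx ?mp ?orbT //=; first by rewrite ek.
      by rewrite !inE; case: (z == k) => //=; case: ifP => _ //; exact: sp.
case: r IHr => // a y b IHr; case: eqP => [eyx [<- <-]|_].
  rewrite eyx; split=> /=; rewrite -?catA ?mem_cat /= ?inE ?mem_cat ?inE ?eqxx ?orbT // => z w zx zk.
  case: (ltngtP w k) => wk; case: (ltngtP w x) => wx; rewrite /= ?wk ?wx ?inE ?(negbTE zx) ?(negbTE zk) //; try lia.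
case E: rotup => [[r' p']|] // [<- <-]; have [ek mx mp sp] := IHr _ _ E.
split=> [|||z w zx zp]; rewrite ?(mem_keys _ _ (Node a y b)) ?mx ?mp ?orbT //=; first by rewrite ek.
by rewrite !inE; case: (z == k) => //=; do 2!case: ifP => _ //; exact: sp.
Qed.

Lemma rotsP xs t t' E : rots xs t = Some (t', E) ->
  [/\ keys t' = keys t, {subset E <= keys t} &
      forall z y, z \notin E -> (z \in spath y t') = (z \in spath y t)].
Proof.
elim: xs t t' E => [|x xs IH] t t' E /=; first by case=> <- <-.
case R: rotup => [[t1 p]|] //; case RS: rots => [[t2 E2]|] // [<- <-].
have [k1 mx mp s1] := rotupP R; have [k2 sE s2] := IH _ _ _ RS.
split; first by rewrite k2.
  by move=> z; rewrite !inE => /or3P[/eqP->|/eqP->|/sE]; rewrite ?k1.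
by move=> z y; rewrite !inE !negb_or => /and3P[zx zp zE]; rewrite s2 // s1.
Qed.

(** Hence every key whose descendants change is charged in the cost. *)
Lemma sub_steiner t E : interval_tree t -> {subset E <= keys t} ->
  {subset E <= steiner t E}.
Proof.
move=> it sE e eE; rewrite mem_filter sE // andbT; apply/andP; split.
  by apply/hasP; exists e => //; apply: spath_self => //; apply: sE.
by apply/allP => w _; apply/implyP => /allP; apply.
Qed.

(* If the pending query was on side b and its pair is still untouched, then a
   transition point lies on the other side. *)
Definition reachable_state (t v : tree) (o : option bool) : Prop :=
  if o is Some b then exists2 z, transition t v z & (z <= root_key v) != b else True.

(** If a transition point is touched, it pays for one pair and the state is reset. Otherwise all of
    them survive and lie opposite to a query [q] below [v], since the search would have touched them
    on its own side; so [q] agrees with a pending letter and completes no pair. *)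
Lemma transition_step t t' v q X (U : seq nat) o :
  interval_tree t -> {subset spath q t <= U} ->
  (forall z y, z \notin U -> (z \in spath y t') = (z \in spath y t)) ->
  (exists z, transition t v z) -> reachable_state t v o ->
  exists2 o', reachable_state t' v o' &
    alt_pairs o (sides v (q :: X)) <= has (transition t v) U + alt_pairs o' (sides v X).
Proof.
move=> it qU inv [z0 tz0] ro.
have [tU|/hasPn ntU] := boolP (has _ U).
  exists None => //=; rewrite /sides /=.
  case: ifP => _ /=; rewrite -/(sides v X); last by have /andP[] := alt_pairs_mono o (sides v X).
  case: o {ro} => [b|] /=; last by have /andP[] := alt_pairs_mono (Some (q <= root_key v)) (sides v X).
  by case: eqP => _ //; have /andP[] := alt_pairs_mono (Some b) (sides v X).
have keep z : transition t v z -> transition t' v z.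
  move=> tz; have zU : z \notin U by apply/negP => /ntU; rewrite tz.
  by move: tz; congr is_true; congr [&& _, _ & ~~ _]; apply: eq_all => x; rewrite inv.
have off z : transition t v z -> q \in keys v -> (z <= root_key v) != (q <= root_key v).
  move=> tz qv; apply/negP => zq.
  have zP : z \in spath q t.
    by case/and3P: tz => _ /allP /(_ q qv) /implyP h _; apply: h; rewrite eq_sym.
  by have := ntU z (qU z zP); rewrite tz.
rewrite /sides /=; case: ifP => [qv|_].
  exists (Some (q <= root_key v)); first by exists z0; [apply: keep|apply: off].
  case: o ro => [b [z tz zb]|_] //=.
  suff -> : q <= root_key v = b by rewrite eqxx.
  by move: (off z tz qv) zb; case: (z <= _); case: (q <= _); case: b.
exists o => //.
by case: o ro => [b [z tz zb]|_] //; exists z => //; apply: keep.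
Qed.

Lemma exec_lower_bound T t X R (o : tree -> option bool) c Ts :
  interval_tree T -> full T -> keys t = keys T -> 0 < size (keys T) ->
  (forall v, v \in inner T -> reachable_state t v (o v)) ->
  exec t X R = Some (c, Ts) ->
  size X + \sum_(v <- inner T) alt_pairs (o v) (sides v X) <= c.
Proof.
move=> iT fT + nT; elim: X t R o c Ts => [|q X IH] t [|xs R] o c Ts kt ro //=.
  move=> [<- _]; rewrite add0n leqn0 big1 // => v _; exact: lt0n_neq0.
case E: rots => [[t' E']|] //; case X': exec => [[c' Ts']|] // [<- _].
have [kt' sE inv] := rotsP E.
have it : interval_tree t by case: iT => a h; exists a; rewrite kt.
set U := _ ++ _.
have invU z y : z \notin U -> (z \in spath y t') = (z \in spath y t).
  rewrite mem_cat negb_or => /andP[_ zs]; apply: inv.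
  by apply: contra zs; apply: sub_steiner.
have pU : {subset spath q t <= U} by move=> z zq; rewrite mem_cat zq.
have step v : v \in inner T -> exists o', reachable_state t' v o' /\
    alt_pairs (o v) (sides v (q :: X)) <= has (transition t v) U + alt_pairs o' (sides v X).
  move=> vT.
  have ex : exists z, transition t v z.
    have := inner_is_inner vT; have := inner_full fT vT; have := inner_interval iT vT.
    have := inner_keys vT.
    case: v vT => // l k r vT sv iv fv nv; have [_ nr _ _] := full_inner_node fv nv.
    by apply: transition_exists => // z /sv; rewrite kt.
  by have [o' r' h] := transition_step X it pU invU ex (ro v vT); exists o'.
(* Finite choice along the list [inner T] gathers the new states into one function. *)
have [o' ho'] : exists o' : tree -> option bool, forall v, v \in inner T ->
    reachable_state t' v (o' v) /\
    alt_pairs (o v) (sides v (q :: X)) <= has (transition t v) U + alt_pairs (o' v) (sides v X).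
  elim: (inner T) step => [|v vs IHv] st; first by exists (fun=> None).
  have [w wv|o1 h1] := IHv; first by apply: st; rewrite inE wv orbT.
  have [o2 h2] := st v (mem_head _ _).
  exists (fun w => if w == v then o2 else o1 w) => w; rewrite inE.
  by case: eqP => [->|_] //=; apply: h1.
have IHc := IH t' R o' c' Ts' (etrans kt' kt) (fun v vi => (ho' v vi).1) X'.
have [l [k [r et]]] : exists l k r, t = Node l k r.
  by case: (t) kt => [h|l k r _]; [move: nT; rewrite -h | exists l, k, r].
have kU : k \in U by apply: pU; rewrite et /= inE eqxx.
have tc := touched_count iT et kU.
have le : \sum_(v <- inner T) alt_pairs (o v) (sides v (q :: X)) <=
    \sum_(v <- inner T) (has (transition t v) U + alt_pairs (o' v) (sides v X)).
  by rewrite !big_seq; apply: leq_sum => v /ho'[].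
rewrite big_split /= in le.
by apply: leq_trans (leq_add tc IHc); rewrite /= !addSn ltnS addnCA leq_add2l.
Qed.

(** * Greedy Future is static *)

Lemma ltlex_asym p q : ltlex p q -> ltlex q p = false.
Proof. by case: p q => [a b] [c d]; rewrite /ltlex /=; lia. Qed.

Lemma amin_head p ps : (forall x, x \in ps -> ltlex p x) -> amin (p :: ps) = 0.
Proof.
case: ps => // p' ps lt; rewrite [amin _]/= -[if ps is _ :: _ then _ else _]/(amin (p' :: ps)).
have jl : amin (p' :: ps) < size (p' :: ps).
  elim: ps p' {lt} => // b ps IH a; rewrite [amin _]/=.
  by case: ifP => // _; apply: (IH b).
by rewrite (ltlex_asym (lt _ (mem_nth p jl))).
Qed.

Lemma amin_last ps p : (forall x, x \in ps -> ltlex p x) ->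
  amin (rcons ps p) = size ps.
Proof.
elim: ps => // a ps IH lt.
have {}IH : amin (rcons ps p) = size ps by apply: IH => x xs; rewrite lt // inE xs orbT.
rewrite rcons_cons [amin _]/= IH nth_rcons ltnn eqxx lt ?mem_head //=.
by case: ps {IH lt}.
Qed.

Lemma sort_rcons s k : uniq (k :: s) -> (forall x, x \in s -> x < k) ->
  sort leq (k :: s) = rcons (sort leq s) k.
Proof.
move=> us lt; apply: (sorted_eq leq_trans anti_leq).
- exact: (sort_sorted leq_total).
- rewrite -cats1 (sorted_pairwise leq_trans) pairwise_cat /= andbT.
  rewrite -(sorted_pairwise leq_trans) (sort_sorted leq_total) andbT.
  by apply/allrelP => x y; rewrite mem_sort inE => /lt h /eqP->; apply: ltnW.
- by rewrite perm_sort perm_sym perm_rcons perm_cons perm_sort.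
Qed.

Lemma sort_cons s k : (forall x, x \in s -> k < x) ->
  sort leq (k :: s) = k :: sort leq s.
Proof.
move=> lt; apply: (sorted_eq leq_trans anti_leq).
- exact: (sort_sorted leq_total).
- rewrite /= (path_sortedE leq_trans) (sort_sorted leq_total) andbT.
  by apply/allP => x; rewrite mem_sort => /lt/ltnW.
- by rewrite perm_sort perm_cons perm_sym perm_sort.
Qed.

Lemma size_hang_mem q t : interval_tree t -> q \in keys t ->
  size (hang q t) = (size (spath q t)).+1.
Proof.
elim: t => // l IHl k r IHr /interval_node[il ir lk rk]; rewrite mem_keys /=.
case: ltngtP => //= qk; rewrite ?orbF.
  by case/orP => [/(IHl il) h|/rk]; [rewrite size_rcons h|lia].
by case/orP => [/lk|/(IHr ir)->//]; lia.
Qed.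

Lemma spath_uniq q t : interval_tree t -> uniq (spath q t).
Proof.
elim: t => // l IHl k r IHr /interval_node[il ir lk rk] /=.
case: ltngtP => //= qk; rewrite ?IHl ?IHr // andbT.
  by apply/negP => /spath_sub /lk; rewrite ltnn.
by apply/negP => /spath_sub /rk; rewrite ltnn.
Qed.

(** The root has the least priority, and the rest of the path lies on one side of it, so it is the
    first or last sorted key. The treap puts it back on top and recursion handles the rest. *)
Lemma build_static t q (pr : nat -> nat * nat) : interval_tree t -> q \in keys t ->
  (forall i j, i < j < size (spath q t) ->
     ltlex (pr (nth 0 (spath q t) i)) (pr (nth 0 (spath q t) j))) ->
  build (size (spath q t)) [seq (v, pr v) | v <- sort leq (spath q t)] (hang q t) = t.
Proof.
elim: t => // l IHl k r IHr it; have [il ir lk rk] := interval_node it.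
have := spath_uniq q it.
rewrite mem_keys /=; case: (ltngtP q k) => qk //= us.
- rewrite ?orbF; case/orP => [ql|/rk]; last by lia.
  move=> inc; set P := spath q l in inc us *.
  have sP : {subset P <= keys l} by apply: spath_sub.
  have lt x : x \in P -> ltlex (pr k) (pr x).
    by move=> /(nthP 0)[i i1 <-]; apply: (inc 0 i.+1).
  rewrite sort_rcons // => [|x /sP/lk//]; rewrite map_rcons /=.
  set vs := map _ _.
  have -> : amin (map snd (rcons vs (k, pr k))) = size vs.
    rewrite map_rcons amin_last ?size_map //= => x.
    by rewrite -map_comp => /mapP[w]; rewrite mem_sort => /lt h ->.
  have szv : size vs = size P by rewrite size_map size_sort.
  have szh : size (hang q l) = (size vs).+1 by rewrite szv size_hang_mem.
  case E: (rcons vs _) => [|a s]; first by case: (vs) E.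
  rewrite -E map_rcons -!cats1 take_size_cat // (drop_oversize (s := vs ++ _)) ?size_cat ?addn1 //.
  rewrite -szh take_size_cat // drop_size_cat // nth_cat size_map ltnn subnn /=.
  congr Node; last by case: (size P).
  by apply: IHl => // i j ij; apply: (inc i.+1 j.+1).
- rewrite ?orbF; case/orP => [/lk|qr]; first by lia.
  move=> inc; set P := spath q r in inc us *.
  have sP : {subset P <= keys r} by apply: spath_sub.
  have lt x : x \in P -> ltlex (pr k) (pr x).
    by move=> /(nthP 0)[i i1 <-]; apply: (inc 0 i.+1).
  rewrite sort_cons => [|x /sP/rk//]; rewrite [map _ _]/=.
  set vs := map _ (sort _ _).
  have -> : amin (map snd ((k, pr k) :: vs)) = 0.
    rewrite [map _ _]/= amin_head // => x.
    by rewrite -map_comp => /mapP[w]; rewrite mem_sort => /lt h ->.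
  rewrite /= take0 !drop0; congr Node; first by case: (size P).
  by apply: IHr => // i j ij; apply: (inc i.+1 j.+1).
Qed.

(** * Next-access times along the search path *)

(** The interval of [tau] without indices into the sorted path: no path key other than [v] cuts [y]
    off from [v]. This form can be followed down the tree. *)
Definition separated (P : seq nat) (v y : nat) : bool :=
  all (fun w => ((w < v) ==> (w < y)) && ((v < w) ==> (y < w))) P.

Lemma in_open_separated (vs : seq nat) (i y : nat) : sorted ltn vs -> i < size vs ->
  in_open (if i == 0 then None else Some (nth 0 vs i.-1))
          (if i.+1 < size vs then Some (nth 0 vs i.+1) else None) y =
  separated vs (nth 0 vs i) y.
Proof.
move=> so iv; have mono a b : a < b < size vs -> nth 0 vs a < nth 0 vs b.
  by move=> ab; apply: (sorted_ltn_nth ltn_trans 0 so); rewrite ?inE; lia.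
have le a b : a <= b < size vs -> nth 0 vs a <= nth 0 vs b.
  move=> /andP[]; rewrite leq_eqVlt => /orP[/eqP->//|ab bs].
  by apply/ltnW/mono; rewrite ab.
apply/idP/allP => [/andP[lo hi] w /(nthP 0)[j js <-]|h].
  have {}js : j < size vs by exact: js.
  case: (ltngtP j i) => ji; last by rewrite ji ltnn.
    have i0 : (i == 0) = false by lia.
    rewrite i0 in lo; rewrite [_ < nth 0 vs j]ltnNge (ltnW (mono j i _)) ?ji //= andbT.
    by apply/implyP => _; apply: leq_ltn_trans lo; apply: le; lia.
  have i1 : i.+1 < size vs by lia.
  rewrite i1 in hi; rewrite [nth 0 vs j < _]ltnNge (ltnW (mono i j _)) ?ji //=.
  by apply/implyP => _; apply: leq_trans hi _; apply: le; lia.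
apply/andP; split.
  case: eqP => // i0; have lti : nth 0 vs i.-1 < nth 0 vs i by apply: mono; lia.
  have /h : nth 0 vs i.-1 \in vs by rewrite mem_nth // (leq_ltn_trans (leq_pred i)).
  by rewrite lti => /andP[].
case: ifP => // i1; have lti : nth 0 vs i < nth 0 vs i.+1 by apply: mono; lia.
by have := h _ (mem_nth 0 i1); rewrite lti => /andP[].
Qed.

Lemma filter_find (a : pred nat) s : has a s ->
  filter a s = nth 0 s (find a s) :: filter a (drop (find a s).+1 s).
Proof. by elim: s => //= x s IH; case: ifP => //= _; rewrite drop0. Qed.

Definition next_separated (Y : seq nat) (q : nat) (v : tree) : Prop :=
  forall y s, sub_seq v Y = y :: s -> separated (spath q v) (root_key v) y.

(** For [i = 0] take the first later query below [t]: it is adjacent to the root and no later than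
    [s]. For [i > 0], adjacency to a deeper node forces query [s] into the child containing [q], and
    the claim for that child lifts because all its keys lie on one side of the root. *)
Lemma tau_path_mono t q Y : interval_tree t -> full t -> q \in leaf_keys t ->
  (forall v, v \in inner t -> q \in keys v -> next_separated Y q v) ->
  forall i j s, i < j < size (spath q t) -> s < size Y -> nth 0 Y s \in keys t ->
    separated (spath q t) (nth 0 (spath q t) j) (nth 0 Y s) ->
  exists s', [/\ s' <= s, nth 0 Y s' \in keys t &
    separated (spath q t) (nth 0 (spath q t) i) (nth 0 Y s')].
Proof.
elim: t => // l IHl k r IHr it ft qt nx i j s ij sY st sep.
have [il ir lk rk] := interval_node it.
have [[el er]|[nl nr fl fr]] := full_node ft.
  have : size (spath q (Node l k r)) <= 1 by rewrite el er /=; case: ifP => //; case: ifP.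
  by lia.
have h : is_inner (Node l k r) by rewrite /= nl.
have qk := leaf_keys_sub qt.
case: i ij => [ij|i ij].
  have ht : has (mem (keys (Node l k r))) Y by apply/hasP; exists (nth 0 Y s); rewrite ?mem_nth.
  exists (find (mem (keys (Node l k r))) Y); split.
  - by rewrite leqNgt; apply/negP => /(before_find 0); rewrite /= st.
  - exact: (nth_find 0 ht).
  - have := nx (Node l k r) _ qk _ _ (filter_find ht); rewrite inner_node // mem_head.
    by move/(_ isT); rewrite /=; case: ifP.
case: j ij sep => // j.
have := qt; rewrite leaf_keys_node // mem_cat => /orP[] ql; have := leaf_keys_sub ql.
  move=> /lk qlk; rewrite /= qlk /= !ltnS => ij /andP[/andP[_ kj] sep].
  have /andP[i_j jP] := ij.
  have jl : nth 0 (spath q l) j < k by apply/lk/spath_sub/mem_nth/jP.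
  rewrite jl /= in kj.
  have sl : nth 0 Y s \in keys l.
    by move: st; rewrite mem_keys => /or3P[//|/eqP|/rk]; lia.
  have [v vl qv|s' [s's s'l sep']] := IHl il fl ql _ i j s ij sY sl sep.
    by apply: nx => //; rewrite inner_node // inE mem_cat vl orbT.
  exists s'; split=> //; first by rewrite mem_keys s'l.
  have il' : nth 0 (spath q l) i < k by apply/lk/spath_sub/mem_nth/(ltn_trans i_j jP).
  by rewrite sep' andbT il' (lk _ s'l) /= ltnNge (ltnW il').
move=> /rk qrk; rewrite /= qrk [q < k]ltnNge (ltnW qrk) /= !ltnS => ij /andP[/andP[kj _] sep].
have /andP[i_j jP] := ij.
have jr : k < nth 0 (spath q r) j by apply/rk/spath_sub/mem_nth/jP.
rewrite jr /= in kj.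
have sr : nth 0 Y s \in keys r.
  by move: st; rewrite mem_keys => /or3P[/lk|/eqP|//]; lia.
have [v vr qv|s' [s's s'r sep']] := IHr ir fr ql _ i j s ij sY sr sep.
  by apply: nx => //; rewrite inner_node // inE mem_cat vr !orbT.
exists s'; split=> //; first by rewrite mem_keys s'r !orbT.
have ir' : k < nth 0 (spath q r) i by apply/rk/spath_sub/mem_nth/(ltn_trans i_j jP).
by rewrite sep' andbT ir' (rk _ s'r) /= ltnNge (ltnW ir').
Qed.

Lemma gf_step_static T X t : interval_tree T -> full T ->
  (forall x, x \in X -> x \in leaf_keys T) -> 0 < t <= size X ->
  (forall v, v \in inner T -> nth 0 X t.-1 \in keys v ->
     next_separated (drop t X) (nth 0 X t.-1) v) ->
  gf_step X t T = T.
Proof.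
move=> iT fT XT tX nx; rewrite /gf_step.
set q := nth 0 X t.-1; set P := spath q T; set vs := sort leq P.
have qT : q \in leaf_keys T by apply/XT/mem_nth; lia.
have uP : uniq P by apply: spath_uniq.
have uvs : uniq vs by rewrite sort_uniq.
have svs : sorted ltn vs by rewrite ltn_sorted_uniq_leq uvs (sort_sorted leq_total).
(* Priorities as a function of the key rather than of the sorted index, as [build_static]
   requires. *)
pose pr v := let i := index v vs in
  (tau X t (if i == 0 then None else Some (nth 0 vs i.-1))
           (if i.+1 < size vs then Some (nth 0 vs i.+1) else None), index v P).
set prs := map _ _.
have -> : prs = [seq (v, pr v) | v <- vs].
  rewrite -{1}(mkseq_nth 0 vs) /mkseq -map_comp; apply/eq_in_map => i.
  by rewrite mem_iota add0n => /andP[_ ivs]; rewrite /= /pr index_uniq.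
rewrite /vs size_sort; apply: build_static => //; first exact: leaf_keys_sub.
move=> i j ij; rewrite -/P in ij *.
have /andP[i_j jS] := ij.
have iP : nth 0 P i \in vs by rewrite mem_sort mem_nth // (ltn_trans i_j).
have jP : nth 0 P j \in vs by rewrite mem_sort mem_nth.
have opE w : w \in vs -> in_open
   (if index w vs == 0 then None else Some (nth 0 vs (index w vs).-1))
   (if (index w vs).+1 < size vs then Some (nth 0 vs (index w vs).+1) else None)
   =1 separated P w.
  move=> wv y; rewrite in_open_separated ?index_mem // nth_index //.
  by apply: eq_all_r => x; rewrite mem_sort.
suff le : (pr (nth 0 P i)).1 <= (pr (nth 0 P j)).1.
  by rewrite /ltlex /= (index_uniq 0 jS uP) (index_uniq 0 (ltn_trans i_j jS) uP) i_j andbT orbC -leq_eqVlt.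
rewrite /= /tau leq_add2l (eq_find (opE _ iP)) (eq_find (opE _ jP)).
set Y := drop t X in nx *.
(* If no later query is adjacent to the lower node, its [find] is [size Y], the value that stands
   for infinity. *)
have [hj|] := boolP (has (separated P (nth 0 P j)) Y); last first.
  by rewrite has_find -leqNgt => /(leq_trans (find_size _ _)).
have sY := hj; rewrite has_find in sY.
have [|s' [s's s'T sep]] := tau_path_mono iT fT qT nx ij sY _ (nth_find 0 hj).
  by apply/leaf_keys_sub/XT/(mem_drop (n0 := t))/mem_nth.
apply: leq_trans s's; rewrite leqNgt; apply/negP => /(before_find 0).
by rewrite sep.
Qed.

Lemma gf_run_static T X : (forall t, 0 < t <= size X -> gf_step X t T = T) ->
  forall t, t <= size X -> gf_run T X t = T.
Proof. by move=> st; elim=> // t IH tX; rewrite /= IH ?st //; lia. Qed.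

Lemma exec_nil T X : exists c, exec T X (nseq (size X) [::]) = Some (c, nseq (size X) T) /\
  c <= \sum_(x <- X) size (spath x T).
Proof.
elim: X => [|x X [c [E le]]] /=; first by exists 0; rewrite big_nil.
have -> : steiner T [::] = [::] by rewrite /steiner (eq_filter (a2 := pred0)) ?filter_pred0.
rewrite cats0 E; eexists; split; first by [].
by rewrite big_cons leq_add // size_undup.
Qed.

(** [GF_cost] minimizes over rotation schedules that produce the trees of Greedy Future, and here
    the empty schedule is one of them. *)
Lemma GF_cost_static T X c : (forall t, 0 < t <= size X -> gf_step X t T = T) ->
  GF_cost T X c -> c <= \sum_(x <- X) size (spath x T).
Proof.
move=> st [_ min]; have [c' [E le]] := exec_nil T X.
apply: leq_trans le; apply: min (E); exists c'; rewrite E; congr (Some (_, _)).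
apply: (@eq_from_nth _ Leaf) => [|i]; rewrite size_nseq ?size_map ?size_iota // => iX.
by rewrite nth_nseq iX (nth_map 0) ?size_iota // nth_iota // gf_run_static.
Qed.

(** * Stability and the gap of the next query *)

Definition stable_node X v := [|| strong_node v X, weakL_node v X | weakR_node v X].

Definition class_weakL (v : tree) (x : nat) : nat :=
  if v is Node (Node ll _ lr) _ _ then
    if x \in keys ll then 0 else if x \in keys lr then 1 else 2
  else 0.

Definition class_weakR (v : tree) (x : nat) : nat :=
  if v is Node _ _ (Node ul _ ur) then
    if x \in keys ur then 0 else if x \in keys ul then 1 else 2
  else 0.

Lemma cyclic3P cls s : cyclic3 cls s ->
  exists p, map cls s = cyc3 p (size s).
Proof.
case/hasP=> p _ /allP h; exists p; apply: (@eq_from_nth _ 0) => [|i].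
  by rewrite size_map size_cyc3.
rewrite size_map => si; rewrite (nth_map 0) // (nth_map 0) ?size_iota // nth_iota //.
by apply/eqP/h; rewrite mem_iota.
Qed.

Lemma nth_cyc3 p n i : i < n -> nth 0 (cyc3 p n) i = (i + p) %% 3.
Proof. by move=> si; rewrite (nth_map 0) ?size_iota // nth_iota. Qed.

Lemma cyc3_next p n cls s1 (a b : nat) s2 :
  map cls (s1 ++ a :: b :: s2) = cyc3 p n -> cls b = (cls a).+1 %% 3.
Proof.
move=> e; have sn : n = (size s1 + (size s2).+2).
  by rewrite -(size_cyc3 p n) -e size_map size_cat.
have n0 := @nth_cyc3 p n (size s1); have n1 := @nth_cyc3 p n (size s1).+1.
have e0 : nth 0 (cyc3 p n) (size s1) = cls a.
  by rewrite -e map_cat nth_cat size_map ltnn subnn.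
have e1 : nth 0 (cyc3 p n) (size s1).+1 = cls b.
  by rewrite -e map_cat nth_cat size_map ltnNge leqW // subSnn.
rewrite -e0 -e1 n0 ?n1; [|lia..].
by rewrite -[in RHS]addn1 modnDml addn1.
Qed.

Lemma inner_trans t v w : v \in inner t -> w \in inner v -> w \in inner t.
Proof.
elim: t => // l IHl k r IHr /=; rewrite !mem_cat => /or3P[|vl wv|vr wv].
- by case: ifP => // h; rewrite inE => /eqP->; rewrite inner_node // inE !mem_cat inE.
- by rewrite IHl ?orbT.
- by rewrite IHr ?orbT.
Qed.

Lemma leaf_split T l k r x : interval_tree T -> Node l k r \in inner T ->
  x \in leaf_keys T -> x \in keys (Node l k r) -> (x \in keys l) || (x \in keys r).
Proof.
move=> iT vT xT; rewrite mem_keys => /or3P[->//|/eqP xk|->]; last by rewrite orbT.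
by have := leaf_keys_neq iT vT; rewrite -xk xT.
Qed.

Lemma separated_right P v y :
  (forall w, w \in P -> w = v \/ w < v /\ w < y) -> separated P v y.
Proof.
move=> h; apply/allP => w /h[->|[wv wy]]; first by rewrite ltnn.
by rewrite wy implybT ltnNge ltnW.
Qed.

Lemma separated_left P v y :
  (forall w, w \in P -> w = v \/ v < w /\ y < w) -> separated P v y.
Proof.
move=> h; apply/allP => w /h[->|[wv wy]]; first by rewrite ltnn.
by rewrite wy implybT andbT ltnNge ltnW.
Qed.

(** When the next query crosses to the other side of [v], all path keys below [v] stay on the side
    of [q]. At a weak node the only step that does not cross is from letter 0 to letter 1. *)
Lemma next_separated_stable T X1 q Y v : interval_tree T ->
  (forall x, x \in X1 ++ q :: Y -> x \in leaf_keys T) ->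
  v \in inner T -> stable_node (X1 ++ q :: Y) v -> q \in keys v ->
  next_separated Y q v.
Proof.
move=> iT XT vT st qv y s ys.
have iv := inner_interval iT vT.
have [yv yY] : y \in keys v /\ y \in Y.
  by have := mem_head y s; rewrite -ys mem_filter => /andP[].
have subE : sub_seq v (X1 ++ q :: Y) = sub_seq v X1 ++ q :: y :: s.
  by rewrite /sub_seq filter_cat /= qv -ys.
have qT : q \in leaf_keys T by apply: XT; rewrite mem_cat mem_head orbT.
have yT : y \in leaf_keys T by apply: XT; rewrite mem_cat inE yY !orbT.
have cross l k r : v = Node l k r -> (q \in keys l) && (y \in keys r) ||
    (q \in keys r) && (y \in keys l) -> separated (spath q v) (root_key v) y.
  move=> ev; rewrite ev in iv *; have [il ir lk rk] := interval_node iv.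
  case/orP => /andP[]; [move=> /lk qk /rk yk | move=> /rk qk /lk yk].
    apply: separated_right => w; rewrite /= qk inE => /orP[/eqP|/spath_sub/lk wk]; first by left.
    by right; split=> //; apply: ltn_trans yk.
  apply: separated_left => w; rewrite /= qk [q < k]ltnNge (ltnW qk) /= inE.
  case/orP=> [/eqP|/spath_sub/rk wk]; first by left.
  by right; split=> //; apply: ltn_trans wk.
case/or3P: st => [|st|st].
- case: v vT iv yv subE cross qv ys => // l k r vT iv yv subE cross qv ys.
  rewrite /strong_node subE => /(cat_sorted2 (s := _))[_ /andP[ne _]].
  apply: (cross _ _ _ erefl).
  have := leaf_split iT vT qT qv; have := leaf_split iT vT yT yv.
  by move: ne; case: (q \in keys l); case: (y \in keys l) => //= _ h1 h2; rewrite ?h1 ?h2 ?orbT.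
- case: v vT iv yv subE cross qv ys st => // -[|ll ku lr] k r vT iv yv subE cross qv ys // /andP[iu].
  rewrite subE => /cyclic3P[p /cyc3_next].
  have uT : Node ll ku lr \in inner T.
    apply: (inner_trans vT); rewrite inner_node // inE mem_cat; apply/orP; right.
    by rewrite inner_node // mem_head.
  have [il ir lk rk] := interval_node iv; have [ill ilr llk lrk] := interval_node il.
  have mq := leaf_split iT vT qT qv; have my := leaf_split iT vT yT yv.
  have mq' := leaf_split iT uT qT; have my' := leaf_split iT uT yT.
  (* Letter 0 followed by 1: path keys other than [k] are at most [ku], and [y] lies between [ku]
     and [k]. *)
  case qll: (q \in keys ll).
    case: ifP => // yll; case: ifP => // ylr _.
    have qku := llk _ qll; have kuy := lrk _ ylr.
    have quk : q < k by apply: lk; rewrite mem_keys qll.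
    have yk : y < k by apply: lk; rewrite mem_keys ylr !orbT.
    have kuk : ku < k by apply: lk; rewrite mem_keys eqxx !orbT.
    apply: separated_right => w; rewrite /= quk qku !inE.
    case/or3P=> [/eqP|/eqP->|/spath_sub/llk wku]; [by left | by right |].
    by right; rewrite (ltn_trans wku kuk) (ltn_trans wku kuy).
  case qlr: (q \in keys lr).
    case: ifP => // yll; case: ifP => // ylr _.
    apply: (cross _ _ _ erefl); rewrite mem_keys qlr !orbT /=.
    case/orP: my => [/my'|->//]; by rewrite yll ylr.
  case: ifP => [yll _|_]; last by case: (y \in keys lr).
  apply: (cross _ _ _ erefl); rewrite [y \in keys (Node _ _ _)]mem_keys yll /= andbT.
  by case/orP: mq => [/mq'|->]; rewrite ?qll ?qlr // orbT.
- case: v vT iv yv subE cross qv ys st => // l k [|ul ku ur] vT iv yv subE cross qv ys // /andP[iu].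
  rewrite subE => /cyclic3P[p /cyc3_next].
  have uT : Node ul ku ur \in inner T.
    apply: (inner_trans vT); rewrite inner_node; last by rewrite /= orbT.
    by rewrite inE mem_cat inner_node // mem_head !orbT.
  have [il ir lk rk] := interval_node iv; have [iul iur ulk urk] := interval_node ir.
  have mq := leaf_split iT vT qT qv; have my := leaf_split iT vT yT yv.
  have mq' := leaf_split iT uT qT; have my' := leaf_split iT uT yT.
  case qur: (q \in keys ur).
    case: ifP => // yur; case: ifP => // yul _.
    have qku := urk _ qur; have kuy := ulk _ yul.
    have quk : k < q by apply: rk; rewrite mem_keys qur !orbT.
    have yk : k < y by apply: rk; rewrite mem_keys yul.
    have kuk : k < ku by apply: rk; rewrite mem_keys eqxx !orbT.
    apply: separated_left => w.
    rewrite /= quk qku [q < k]ltnNge (ltnW quk) [q < ku]ltnNge (ltnW qku) /= !inE.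
    case/or3P=> [/eqP|/eqP->|/spath_sub/urk wku]; [by left | by right |].
    by right; rewrite (ltn_trans kuk wku) (ltn_trans kuy wku).
  case qul: (q \in keys ul).
    case: ifP => // yur; case: ifP => // yul _.
    apply: (cross _ _ _ erefl); rewrite [q \in keys (Node _ _ _)]mem_keys qul /= orbC /=.
    case/orP: my => [->//|/my']; by rewrite yul yur.
  case: ifP => [yur _|_]; last by case: (y \in keys ul).
  apply: (cross _ _ _ erefl); rewrite [y \in keys (Node _ _ _)]mem_keys yur !orbT andbT.
  by case/orP: mq => [->//|/mq']; rewrite qur qul.
Qed.

(** * Side words at strong and weak nodes *)

Lemma sides_cat v X Y : sides v (X ++ Y) = sides v X ++ sides v Y.
Proof. by rewrite /sides /sub_seq filter_cat map_cat. Qed.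

Lemma mem_left T l k r X : interval_tree T -> Node l k r \in inner T ->
  (forall x, x \in X -> x \in leaf_keys T) ->
  {in sub_seq (Node l k r) X, forall x, (x <= k) = (x \in keys l)}.
Proof.
move=> iT vT XT x; rewrite mem_filter => /andP[xv xX].
have [_ _ lk rk] := interval_node (inner_interval iT vT).
case/orP: (leaf_split iT vT (XT x xX) xv) => h.
  by rewrite h (ltnW (lk _ h)).
by rewrite leqNgt rk //=; apply/esym/negbTE/negP => /lk; have := rk _ h; lia.
Qed.

Lemma strong_alternating T X v : interval_tree T -> v \in inner T ->
  (forall x, x \in X -> x \in leaf_keys T) -> strong_node v X = alternating (sides v X).
Proof.
case: v => [|l k r] iT vT XT; first by have := inner_is_inner vT.
rewrite /alternating /sides sorted_map; apply: (eq_in_sorted (P := mem (sub_seq (Node l k r) X))).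
  by move=> a b aP bP /=; rewrite !(mem_left iT vT XT).
exact/allP.
Qed.

(** One cyclic word determines the side words of both [v] and its favored child [u]; the bit [b]
    flips left and right, so that both biases are covered. *)
Definition weakly_coded X (v u : tree) (p n : nat) : Prop :=
  exists b,
    sides v X = [seq (c != 2) (+) b | c <- cyc3 p n] /\
    sides u X = [seq (c == 0) (+) b | c <- cyc3 p n & c != 2].

Lemma sub_seq_sub (u v : tree) X : {subset keys u <= keys v} ->
  sub_seq u X = [seq x <- sub_seq v X | x \in keys u].
Proof.
move=> uv; rewrite /sub_seq -filter_predI; apply: eq_filter => x /=.
by case h: (x \in keys u); rewrite // (uv _ h).
Qed.

Lemma weakL_coded T X ll ku lr k r p n : interval_tree T ->
  (forall x, x \in X -> x \in leaf_keys T) ->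
  let u := Node ll ku lr in let v := Node u k r in
  v \in inner T -> u \in inner T ->
  map (class_weakL v) (sub_seq v X) = cyc3 p n -> weakly_coded X v u p n.
Proof.
move=> iT XT u v vT uT e; exists false.
have [iu ir lk rk] := interval_node (inner_interval iT vT).
have [ill ilr llk lrk] := interval_node iu.
have mv := mem_left iT vT XT; have mu := mem_left iT uT XT.
have uv : {subset keys u <= keys v} by move=> x xu; rewrite mem_keys xu.
have cu x : x \in sub_seq v X -> (x \in keys u) = (class_weakL v x != 2).
  rewrite mem_filter => /andP[_ xX]; have split_u := leaf_split iT uT (XT x xX).
  rewrite /=; case inA: (x \in keys ll); first by rewrite mem_keys inA ?orbT.
  case inB: (x \in keys lr); first by rewrite mem_keys inB ?orbT.
  by apply/negP => /split_u; rewrite inA inB.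
split.
  rewrite -e -map_comp; apply/eq_in_map => x xs /=; rewrite addbF.
  by rewrite (mv x xs) (cu x xs).
rewrite -e filter_map -map_comp /sides (sub_seq_sub _ uv).
rewrite (eq_in_filter cu) /=; apply/eq_in_map => x.
rewrite mem_filter -(andbC (x \in _)) => /andP[xs xc]; rewrite /= addbF.
have xu : x \in sub_seq u X by rewrite (sub_seq_sub _ uv) mem_filter xs cu // xc.
by rewrite (mu x xu); case: ifP => //; case: ifP.
Qed.

Lemma weakR_coded T X l k ul ku ur p n : interval_tree T ->
  (forall x, x \in X -> x \in leaf_keys T) ->
  let u := Node ul ku ur in let v := Node l k u in
  v \in inner T -> u \in inner T ->
  map (class_weakR v) (sub_seq v X) = cyc3 p n -> weakly_coded X v u p n.
Proof.
move=> iT XT u v vT uT e; exists true.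
have [il iu lk rk] := interval_node (inner_interval iT vT).
have [iul iur ulk urk] := interval_node iu.
have mv := mem_left iT vT XT; have mu := mem_left iT uT XT.
have uv : {subset keys u <= keys v} by move=> x xu; rewrite mem_keys xu !orbT.
have cu x : x \in sub_seq v X -> (x \in keys u) = (class_weakR v x != 2).
  rewrite mem_filter => /andP[_ xX]; have split_u := leaf_split iT uT (XT x xX).
  rewrite /=; case inA: (x \in keys ur); first by rewrite mem_keys inA ?orbT.
  case inB: (x \in keys ul); first by rewrite mem_keys inB ?orbT.
  by apply/negP => /split_u; rewrite inA inB.
split.
  rewrite -e -map_comp; apply/eq_in_map => x xs /=; rewrite addbT negbK.
  rewrite (mv x xs) -[_ == 2]negbK -(cu x xs).
  move: xs; rewrite mem_filter => /andP[xv xX].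
  case/orP: (leaf_split iT vT (XT x xX) xv) => h; rewrite h /=.
    by apply/esym/negP => /rk; have := lk _ h; lia.
  by apply/negbTE/negP => /lk; have := rk _ h; lia.
rewrite -e filter_map -map_comp /sides (sub_seq_sub _ uv).
rewrite (eq_in_filter cu) /=; apply/eq_in_map => x.
rewrite mem_filter -(andbC (x \in _)) => /andP[xs xc]; rewrite /= addbT.
have xu : x \in sub_seq u X by rewrite (sub_seq_sub _ uv) mem_filter xs cu // xc.
rewrite (mu x xu); move: xc; case: ifP => /= [h _|_].
  by apply/negbTE/negP => /ulk; have := urk _ h; lia.
by case: ifP.
Qed.

(** * Counting *)

Lemma cyc3_cat p m n : exists s, cyc3 p (m + n) = cyc3 p m ++ s /\ size s = n.
Proof.
exists [seq (i + p) %% 3 | i <- iota m n]; rewrite size_map size_iota.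
by rewrite /cyc3 iotaD map_cat.
Qed.

Lemma cyc3_take p n s1 s2 : s1 ++ s2 = cyc3 p n -> s1 = cyc3 p (size s1).
Proof.
move=> e; have en : n = size s1 + size s2 by rewrite -size_cat e size_cyc3.
have [s [h _]] := cyc3_cat p (size s1) (size s2).
by move/eqP: e; rewrite en h eqseq_cat ?size_cyc3 // => /andP[/eqP].
Qed.

(** By commutation [s2] is also a prefix, so it starts in phase [p]; it occurs after [s1] as well,
    so the length of [s1] is a multiple of the period. *)
Lemma commuting_cyc3 p n s1 s2 : s2 != [::] -> s1 ++ s2 = s2 ++ s1 ->
  s1 ++ s2 = cyc3 p n -> 3 %| size s1.
Proof.
move=> s20 comm e; have e1 := cyc3_take e.
have e2 : s2 = cyc3 p (size s2) by apply: (@cyc3_take p n s2 s1); rewrite -comm.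
have en : n = size s1 + size s2 by rewrite -size_cat e size_cyc3.
apply: (@cyc3_periodic p (size s2)); first by case: (s2) s20.
by rewrite -e1 -e2 e en.
Qed.

(** Nonempty commuting words share their first letter, so [s1] still alternates when closed into a
    cycle. *)
Lemma commuting_alternating s1 s2 : s2 != [::] -> s1 ++ s2 = s2 ++ s1 ->
  alternating (s1 ++ s2) -> ~~ odd (size s1).
Proof.
case: s2 => // b s2 _; case: s1 => // a s1 comm alt.
apply: alternating_cyclic_even.
have ab : b = a by case: comm.
move: alt; rewrite -cat_rcons => /cat_sorted2[].
by rewrite ab.
Qed.

Lemma alternating_addb (f : nat -> bool) b s :
  alternating [seq f x (+) b | x <- s] = alternating (map f s).
Proof.
rewrite /alternating !sorted_map; apply: eq_sorted => x y /=.
by case: (f x); case: (f y); case: b.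
Qed.

Definition occ X v := size (sides v X).
Definition pairs X v := alt_pairs None (sides v X).

Definition total (f : tree -> nat) t := \sum_(v <- inner t) f v.

Lemma total_node f l k r : is_inner (Node l k r) ->
  total f (Node l k r) = f (Node l k r) + (total f l + total f r).
Proof. by move=> h; rewrite /total inner_node // big_cons big_cat. Qed.

Lemma total_leaf f l k r : ~~ is_inner (Node l k r) -> total f (Node l k r) = 0.
Proof.
by case: l r => [|? ? ?] [|? ? ?] //; rewrite /total /= big_nil.
Qed.

Definition weak_case X v u : Prop :=
  is_inner u /\ exists p c, weakly_coded X v u p (c * 3).

Definition node_case X v : Prop :=
  occ X v <= (pairs X v).*2 \/
  if v is Node l _ r then weak_case X v l \/ weak_case X v r else False.

(** Stability is used for [X ++ A], one repetition beyond [X]. The extra copy makes the word of [X]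
    at [v] close up cyclically: even length at a strong node, a multiple of 3 at a weak one. *)
Lemma node_caseP T X A v : interval_tree T ->
  (forall x, x \in X -> x \in leaf_keys T) -> {subset X <= A} -> {subset A <= X} ->
  X ++ A = A ++ X -> v \in inner T -> stable_node (X ++ A) v -> node_case X v.
Proof.
move=> iT XT XA AX comm vT st.
have XAT x : x \in X ++ A -> x \in leaf_keys T.
  by rewrite mem_cat => /orP[/XT|/AX/XT].
(* If [A] has no query below [v], neither has [X], and both counts vanish. *)
have [s0|sn] := eqVneq (sub_seq v A) [::].
  left; rewrite /occ /pairs; suff -> : sides v X = [::] by [].
  rewrite /sides (_ : sub_seq v X = [::]) //; apply/eqP; rewrite -[_ == _]negbK -has_filter.
  apply/negP => /hasP[x /XA xA xv].
  by have := mem_filter (mem (keys v)) x A; rewrite [filter _ _]s0 /= xv xA.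
have cs : sub_seq v X ++ sub_seq v A = sub_seq v A ++ sub_seq v X.
  by rewrite /sub_seq -!filter_cat comm.
have nm (f : nat -> nat) : map f (sub_seq v A) != [::] by case: (sub_seq v A) sn.
have cyc (cls : nat -> nat) : cyclic3 cls (sub_seq v (X ++ A)) ->
    exists p c, map cls (sub_seq v X) = cyc3 p (c * 3).
  case/cyclic3P=> p; rewrite {1}/sub_seq filter_cat map_cat => e.
  have /dvdnP[c sc] : 3 %| size (map cls (sub_seq v X)).
    by apply: (commuting_cyc3 (nm cls) _ e); rewrite -!map_cat cs.
  by exists p, c; rewrite -sc; apply: cyc3_take e.
case/or3P: st => st.
- left; move: st; rewrite (strong_alternating iT vT XAT) sides_cat => alt.
  have ev : ~~ odd (size (sides v X)).
    apply: commuting_alternating alt; last by rewrite -!sides_cat comm.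
    by rewrite /sides; case: (sub_seq v A) sn.
  have /alternating_pairs : alternating (sides v X) by case/cat_sorted2: alt.
  by rewrite /occ /pairs; lia.
- right; case: v vT {sn cs nm} cyc st => // -[|ll ku lr] k r // vT cyc /andP[iu] /cyc[p [c e]].
  left; split=> //; exists p, c; apply: (weakL_coded iT XT vT _ e).
  by apply: (inner_trans vT); rewrite inner_node // inE mem_cat (inner_node iu) mem_head orbT.
- right; case: v vT {sn cs nm} cyc st => // l k [|ul ku ur] // vT cyc /andP[iu] /cyc[p [c e]].
  right; split=> //; exists p, c; apply: (weakR_coded iT XT vT _ e).
  apply: (inner_trans vT); rewrite inner_node; last by rewrite /= orbT.
  by rewrite inE mem_cat (inner_node iu) mem_head !orbT.
Qed.

Lemma weakly_coded_pairs X v u p c : weakly_coded X v u p (c * 3) ->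
  [/\ occ X v = c * 3, c <= pairs X v, occ X u = c.*2 & c <= pairs X u].
Proof.
rewrite /occ /pairs.
have neg (s : seq nat) (f : nat -> bool) b :
    alt_pairs None [seq f x (+) b | x <- s] = alt_pairs None (map f s).
  case: b; last by congr alt_pairs; apply: eq_map => x; rewrite addbF.
  rewrite -(alt_pairs_negb None (map f s)) -map_comp.
  by congr alt_pairs; apply: eq_map => x; rewrite /= addbT.
case=> b [-> ->]; have [sz le] := cyc3_favored p c.
rewrite size_map in sz.
by rewrite !neg !size_map size_iota sz; split=> //; apply: cyc3_pairs.
Qed.

Lemma inner_left l k r v : v \in inner l -> v \in inner (Node l k r).
Proof. by move=> vl; rewrite /= !mem_cat vl orbT. Qed.

Lemma inner_right l k r v : v \in inner r -> v \in inner (Node l k r).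
Proof. by move=> vr; rewrite /= !mem_cat vr !orbT. Qed.

(** A weak node is counted together with its favored child: [3c + 2c] queries against at least [2c]
    pairs. The induction is on size because it then continues at the children of the favored
    child. *)
Lemma mixed_count X t : (forall v, v \in inner t -> node_case X v) ->
  2 * total (occ X) t <= 5 * total (pairs X) t.
Proof.
have [n] := ubnP (size (keys t)); elim: n t => // n IH [|l k r].
  by rewrite /total /= !big_nil.
rewrite [keys _]/= size_cat /= => le nc.
have ncl v (vl : v \in inner l) := nc v (inner_left k r vl).
have ncr v (vr : v \in inner r) := nc v (inner_right l k vr).
have IHl : 2 * total (occ X) l <= 5 * total (pairs X) l by apply: IH => //; lia.
have IHr : 2 * total (occ X) r <= 5 * total (pairs X) r by apply: IH => //; lia.
case: (boolP (is_inner (Node l k r))) => h; last by rewrite !total_leaf.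
rewrite !total_node //.
have vT : Node l k r \in inner (Node l k r) by rewrite inner_node // mem_head.
case: (nc _ vT) => {nc vT h}; first by lia.
case=> -[iu [p [c /weakly_coded_pairs[e1 e2 e3 e4]]]].
- case: l iu ncl {IHl} le e1 e2 e3 e4 => // a ku b iu ncl le e1 e2 e3 e4.
  rewrite /= size_cat /= in le.
  have IHa : 2 * total (occ X) a <= 5 * total (pairs X) a.
    by apply: IH => [|v va]; [lia | apply/ncl/inner_left].
  have IHb : 2 * total (occ X) b <= 5 * total (pairs X) b.
    by apply: IH => [|v vb]; [lia | apply/ncl/inner_right].
  by rewrite !total_node //; lia.
- case: r iu ncr {IHr} le e1 e2 e3 e4 => // a ku b iu ncr le e1 e2 e3 e4.
  rewrite /= size_cat /= in le.
  have IHa : 2 * total (occ X) a <= 5 * total (pairs X) a.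
    by apply: IH => [|v va]; [lia | apply/ncr/inner_left].
  have IHb : 2 * total (occ X) b <= 5 * total (pairs X) b.
    by apply: IH => [|v vb]; [lia | apply/ncr/inner_right].
  by rewrite !total_node //; lia.
Qed.

Lemma occE X v : occ X v = count (mem (keys v)) X.
Proof. by rewrite /occ /sides size_map size_filter. Qed.

Lemma occ_mono X v t : v \in inner t -> occ X v <= occ X t.
Proof. by move=> /inner_keys sub; rewrite !occE; apply: sub_count. Qed.

Lemma occ_node X l k r : interval_tree (Node l k r) ->
  occ X l + occ X r <= occ X (Node l k r).
Proof.
move=> /interval_node[_ _ lk rk]; rewrite !occE -count_predUI.
rewrite [Y in _ + Y](_ : _ = 0).
  by rewrite addn0; apply: sub_count => x /=; rewrite mem_cat inE => /orP[]->; rewrite ?orbT.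
apply/eqP; rewrite -leqn0 leqNgt -has_count; apply/hasPn => x _ /=.
by apply/negP => /andP[/lk + /rk]; lia.
Qed.

(** A weak node has [3c] queries, so with at most two queries [c = 0] and the ratio 2 holds at every
    node. *)
Lemma small_count X t : (forall v, v \in inner t -> node_case X v) -> occ X t <= 2 ->
  total (occ X) t <= 2 * total (pairs X) t.
Proof.
move=> nc t2; rewrite /total big_distrr /= !big_seq; apply: leq_sum => v vt.
have v2 := leq_trans (occ_mono X vt) t2.
case: (nc v vt) => [|]; first by lia.
case: v vt v2 => // l k r vt v2.
by case=> -[_ [p [c /weakly_coded_pairs[e1 e2 _ _]]]]; lia.
Qed.

(* Alternating sides rule out weak nodes with more than three queries; the
   remaining ones lie on disjoint triples of queries, whence the slack occ t. *)
Lemma strong_count X t : interval_tree t -> (forall v, v \in inner t -> node_case X v) ->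
  (forall v, v \in inner t -> alternating (sides v X)) ->
  3 * total (occ X) t <= 6 * total (pairs X) t + occ X t.
Proof.
elim: t => [|l IHl k r IHr] it nc al; first by rewrite /total /= big_nil.
have [il ir lk rk] := interval_node it; have node := occ_node X it.
have ncl v (vl : v \in inner l) := nc v (inner_left k r vl).
have ncr v (vr : v \in inner r) := nc v (inner_right l k vr).
have {}IHl := IHl il ncl (fun v vl => al v (inner_left k r vl)).
have {}IHr := IHr ir ncr (fun v vr => al v (inner_right l k vr)).
case: (boolP (is_inner (Node l k r))) => h; last by rewrite !total_leaf.
have vT : Node l k r \in inner (Node l k r) by rewrite inner_node // mem_head.
have alv := al _ vT; rewrite !total_node //.
have weak u : weak_case X (Node l k r) u -> occ X (Node l k r) = 0 \/
    [/\ occ X (Node l k r) = 3, occ X u = 2 & 1 <= pairs X (Node l k r)].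
  case=> _ [p [c wc]]; have [e1 e2 e3 _] := weakly_coded_pairs wc.
  suff : c <= 1 by case: c e1 e2 e3 {wc} => [|[|]] //; [left | right].
  case: wc => b [es _]; rewrite es alternating_addb in alv.
  by have := cyc3_alternating alv; lia.
(* Below a weak node with three queries each child has at most two, so the children need no slack
   and all of it goes to the node: [9 <= 6 + 3]. *)
have Ql := small_count ncl; have Qr := small_count ncr.
case: (nc _ vT) => [le|[/weak|/weak]]; first lia.
- by case=> [v0|[v3 u2 pv]]; [lia | have := Ql (ltac:(lia)); have := Qr (ltac:(lia)); lia].
- by case=> [v0|[v3 u2 pv]]; [lia | have := Ql (ltac:(lia)); have := Qr (ltac:(lia)); lia].
Qed.

Lemma repeat_seqS A k : repeat_seq A k.+1 = A ++ repeat_seq A k.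
Proof. by []. Qed.

Lemma repeat_seq_comm A k : repeat_seq A k ++ A = A ++ repeat_seq A k.
Proof. by elim: k => [|k IH]; rewrite ?cats0 // repeat_seqS -catA IH. Qed.

Lemma mem_repeat_seq A k : {subset repeat_seq A k <= A}.
Proof. by elim: k => // k IH x; rewrite repeat_seqS mem_cat => /orP[//|/IH]. Qed.

(** * The upper bound for Greedy Future and the two ratios *)

Lemma GF_cost_upper T X c : interval_tree T -> mixed_stable T X -> GF_cost T X c ->
  c <= size X + total (occ X) T.
Proof.
move=> iT /andP[/andP[fT /allP XT]]; rewrite all_innerE => /allP st gf.
have step t : 0 < t <= size X -> gf_step X t T = T.
  move=> tX; apply: gf_step_static => // v vT qv.
  (* Times start at 1: the query served at time [t] has index [t.-1], and [drop t X] is its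
     future. *)
  have eX : take t.-1 X ++ nth 0 X t.-1 :: drop t X = X.
    case: t tX {qv} => // t /= tX; rewrite -drop_nth //; exact: cat_take_drop.
  by apply: (@next_separated_stable T (take t.-1 X)); rewrite ?eX //; apply: st.
apply: leq_trans (GF_cost_static step gf) _.
have : all (fun x => x \in leaf_keys T) X by apply/allP.
rewrite /total; elim: (X) => [|x Y IH] /=; first by rewrite big_nil.
case/andP=> xT /IH le; rewrite big_cons.
apply: leq_trans (leq_add (size_spath iT fT xT) le) _.
rewrite addSn addSn ltnS addnCA leq_add2l -big_split /= leq_eqVlt; apply/orP; left.
apply/eqP/eq_bigr => v _; rewrite /occ /sides /sub_seq /=.
by case: (x \in keys v).
Qed.

Theorem theorem5 (n : nat) (T : tree) (X : seq nat) :
  bst_on n T -> X != [::] ->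
  mixed_stable T X -> whole_multiple mixed_stable T X ->
  forall cGF cOPT, GF_cost T X cGF -> OPT_cost T X cOPT ->
    2 * cGF < 5 * cOPT /\ (strongly_stable T X -> cGF < 2 * cOPT).
Proof.
move=> bT X0 mX [A [k [[[_ [Ast _]] _] eX]]] cGF cOPT gf [[R [Ts ex]] _].
have iT : interval_tree T by exists 1; rewrite bT size_iota.
have /andP[/andP[fT /allP XT] _] := mX.
have szX : 0 < size X by case: (X) X0.
have szT : 0 < size (keys T).
  case: (X) X0 XT => // x Y _ /(_ x (mem_head _ _)) /leaf_keys_sub.
  by case: (keys T).
have upper := GF_cost_upper iT mX gf.
(* The initial tree is also the reference tree, and no letter is pending at the start. *)
have lower : size X + total (pairs X) T <= cOPT := exec_lower_bound (o := fun=> None) iT fT erefl szT (fun _ _ => I) ex.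
have XA : {subset X <= A} by rewrite eX; apply: mem_repeat_seq.
have AX : {subset A <= X}.
  case: k eX X0 => [->//|k ->] _ x xA.
  by rewrite repeat_seqS mem_cat xA.
have comm : X ++ A = A ++ X by rewrite eX repeat_seq_comm.
have cases v : v \in inner T -> node_case X v.
  move=> vT; apply: (node_caseP iT XT XA AX comm vT).
  (* The repetition [k.+1] of [A] is [X ++ A]. *)
  have := Ast k.+1 isT; rewrite repeat_seqS -repeat_seq_comm -eX.
  by case/andP => _; rewrite all_innerE => /allP /(_ v vT).
split; first by have := mixed_count cases; lia.
(* The atomic sequence is taken in the mixed sense, so weak nodes may remain although the side words
   of [X] alternate. *)
case/andP => _; rewrite all_innerE => /allP st.
have alt v : v \in inner T -> alternating (sides v X).
  by move=> vT; rewrite -(strong_alternating iT vT XT); apply: st.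
have := strong_count iT cases alt.
(* With [m = size X] the slack is at most [m]: three times the cost of Greedy Future is at most [4m]
   plus six times the pairs, and [4m < 6m]. *)
have : occ X T <= size X by rewrite occE count_size.
by lia.
Qed.
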